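(* A set $F\subset\mathbb{N}$ is an AP-set if and only if for every dynamical system $(X,T)$ and every $x\in X$ there is a multi-non-wandering point of $(X,T)$ in $\overline{T^Fx}$, where $T^Fx=\{T^nx:n\in F\}$.
   Context: A (topological) dynamical system $(X,T)$ consists of a (nonempty) compact metric space and a continuous map $T\colon X\to X$. $\mathbb{N}$ is the set of positive integers. A set $F\subset\mathbb{N}$ is an AP-set if for every $d\ge1$ there are $a,n\in\mathbb{N}$ with $\{a,a+n,\dots,a+dn\}\subset F$. A point $y\in X$ is multi-non-wandering if for every open neighborhood $U$ of $y$ and every $d\in\mathbb{N}$ there exists $n\in\mathbb{N}$ such that $U\cap T^{-n}U\cap T^{-2n}U\cap\dots\cap T^{-dn}U\ne\emptyset$. *)

(* Defs.v *)
From HB Require Import structures.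
From mathcomp Require Import all_boot all_order all_algebra.
From mathcomp Require Import all_classical all_reals all_analysis.

Set Implicit Arguments.
Unset Strict Implicit.
Unset Printing Implicit Defensive.

Local Open Scope classical_set_scope.

Definition dynamical_system (R : realType) (X : metricType R) (T : X -> X) :
    Prop :=
  [/\ [set: X] !=set0, compact [set: X] & continuous T].

(* The positive integers play the role of N, hence the positivity conditions on d, a and n
   here and below. *)
Definition AP_set (F : set nat) : Prop :=
  forall d, 0 < d -> exists a n, [/\ 0 < a, 0 < n &
    [set a + i * n | i in `I_d.+1] `<=` F].

(* The index i = 0 of the intersection contributes U itself. *)
Definition multi_non_wandering (X : topologicalType) (T : X -> X) (y : X) :
    Prop :=
  forall U : set X, open_nbhs y U -> forall d, 0 < d ->
    exists2 n, 0 < n &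
      (\bigcap_(i in `I_d.+1) (iter (i * n) T @^-1` U)) !=set0.

Definition orbit_along (X : Type) (T : X -> X) (F : set nat) (x : X) : set X :=
  [set iter n T x | n in F].

(* Main.v *)
Require Import Defs.
From HB Require Import structures.
From mathcomp Require Import all_boot all_order all_algebra.
From mathcomp Require Import all_classical all_reals all_analysis.
From mathcomp Require Import zify.

(** The engine is van der Waerden's theorem, in the form: if an AP-set is cut
    into finitely many pieces, one of the pieces is an AP-set
    ([AP_set_partition_regular]).

    If [F] is an AP-set, call a set [A] of states large when the times of [F]
    at which the orbit of [x] is in [A] form an AP-set.  Partition regularity
    says that a union of two sets is large only if one of them is, so the sets
    with a non-large complement form a proper filter.  By compactness this
    filter has a cluster point [y], and every neighborhood [U] of [y] is then
    large.  Largeness of [U] gives a visit to [U] at a time of [F], so [y] is in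
    the closure of the orbit along [F]; and it gives visits at times [a],
    [a + n], ..., [a + d n], so the point [T^a x] witnesses that [y] is
    multi-non-wandering.

    Conversely, apply the hypothesis to the indicator word of [F] in its own
    orbit closure under the shift.  Every shift by a time of [F] starts with the
    letter 1, hence so does the multi-non-wandering point [y] which is obtained.
    The words that start with 1 form an open neighborhood of [y]; a word of the
    system with the letter 1 at [0], [n], ..., [d n] must then exist.  Its finite
    prefixes occur in the indicator word, say at position [m], which puts the
    progression [m], [m + n], ..., [m + d n] in [F].  It matters here that the
    system is the orbit closure and not the full shift. *)

Set Implicit Arguments.
Unset Strict Implicit.
Unset Printing Implicit Defensive.

Import Order.TTheory GRing.Theory Num.Theory.

Local Open Scope classical_set_scope.

(** * Van der Waerden's theorem *)

(** The bound is on [a + k * d], one step past the last term of the progression: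
    this next point is the focus in the color-focusing argument. *)
Definition vdw_bound k (C : finType) N := forall c : nat -> C,
  exists a d, [/\ 0 < d, a + k * d < N & forall i, i < k -> c (a + i * d) = c a].

(** The inductive step of van der Waerden's theorem.  Either some progression of
    [k.+1] terms is monochromatic, or there are [s] monochromatic progressions of
    [k] terms, of pairwise distinct colors, all of which continue to the same
    point [f].  To pass from [s] to [s.+1], cut the integers into blocks long
    enough for [s], and see a coloring of a block as a single color: [k] equally
    spaced blocks then look alike.  The focus of the first block is either in one
    of the [s] colors, which completes a progression, or in a fresh color; in
    this last case going diagonally through the blocks moves the [s] progressions
    to a focus in the block that continues the row, and the copies of the old
    focus are a further progression that points there. *)
Lemma color_focusing k (C : finType) s : 0 < k ->
    (forall D : finType, exists N, vdw_bound k D N) ->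
  exists N, forall c : nat -> C,
    (exists a d, [/\ 0 < d, a + k * d < N &
      forall i, i < k.+1 -> c (a + i * d) = c a]) \/
    (exists f (S : {set C}), [/\ f < N, #|S| = s &
      forall x, x \in S -> exists a d, [/\ 0 < d, a + k * d = f &
        forall i, i < k -> c (a + i * d) = x]]).
Proof.
move=> k0 vdw; elim: s => [|s [N focusN]].
  exists 1 => c; right; exists 0, finset.set0.
  by split; rewrite ?cards0// => x; rewrite inE.
have [M vdwM] := vdw {ffun 'I_N -> C}; exists (M * N) => c.
have [b [e [e0 beM block]]] := vdwM (fun j => [ffun t : 'I_N => c (j * N + t)]).
have same i t : i < k -> t < N -> c ((b + i * e) * N + t) = c (b * N + t).
  by move=> ik tN; have /ffunP/(_ (Ordinal tN)) := block i ik; rewrite !ffunE.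
have inMN j t : j <= b + k * e -> t < N -> j * N + t < M * N by nia.
have bk : b <= b + k * e by rewrite leq_addr.
have [[a [d [d0 adN mono]]]|[f [S [fN cardS spokes]]]] :=
    focusN (fun t => c (b * N + t)).
  left; exists (b * N + a), d; split; rewrite -?addnA//; first exact: inMN.
  by move=> i ik; rewrite -addnA mono.
have [|fresh] := boolP (c (b * N + f) \in S).
  move=> /spokes[a [d [d0 adf mono]]]; left; exists (b * N + a), d.
  split; rewrite -?addnA ?adf//; first exact: inMN.
  move=> i; rewrite -addnA ltnS leq_eqVlt => /predU1P[->|ik].
    by rewrite adf -(mono 0)// mul0n addn0.
  by rewrite mono// -(mono 0)// mul0n addn0.
(* The new focus is the copy of [f] in the block that follows the [k] similar ones. *)
right; exists ((b + k * e) * N + f), (c (b * N + f) |: S)%SET; split.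
- exact: inMN.
- by rewrite cardsU1 fresh cardS.
move=> x; rewrite !inE => /predU1P[->|/spokes[a [d [d0 adf mono]]]].
  exists (b * N + f), (e * N); split; first by nia.
    by nia.
  by move=> i ik; rewrite -(same i f ik fN); congr c; nia.
exists (b * N + a), (d + e * N); split; [by nia|by nia|move=> i ik].
rewrite -(mono i ik) -(same i)//; last by nia.
congr c; nia.
Qed.

(** Focusing more progressions than there are colors is impossible, which leaves
    a monochromatic progression with one more term. *)
Lemma van_der_Waerden k (C : finType) : exists N, vdw_bound k.+1 C N.
Proof.
elim: k C => [|k vdw] C.
  by exists 2 => c; exists 0, 1; split=> // -[].
have [N focusN] := color_focusing C #|C|.+1 (ltn0Sn k) vdw.
exists (N + N) => c.
have [[a [d [d0 adN mono]]]|[f [S [_ cardS _]]]] := focusN c.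
  (* As [k.+1 > 0], the step [d] is below [N], so doubling [N] leaves room for the
     point after the last term. *)
  by exists a, d; split=> //; nia.
by have := max_card (mem S); rewrite cardS ltnn.
Qed.

(** A coloring of [F] is read along a long progression contained in [F]: a
    progression of indices gives a progression of elements.  A length that fails
    for each color, and the maximum of these lengths, reduce the claim to a single
    application of van der Waerden's theorem. *)
Lemma AP_set_partition_regular (C : finType) (c : nat -> C) (F : set nat) :
  AP_set F -> exists x, AP_set (F `&` c @^-1` [set x]).
Proof.
move=> apF; apply: contrapT => /forallNP noAP.
have /choice[d dP] x : exists d, 0 < d /\ ~ exists a n, [/\ 0 < a, 0 < n &
    [set a + i * n | i in `I_d.+1] `<=` F `&` c @^-1` [set x]].
  have /existsNP[d /not_implyP[d0 nd]] := noAP x.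
  by exists d.
pose k := \max_x d x.
have [N vdwN] := van_der_Waerden k C.
have [m [n [m0 n0 mnF]]] := apF N.+1 isT.
have [a [e [e0 aeN mono]]] := vdwN (fun i => c (m + i * n)).
have [_ []] := dP (c (m + a * n)).
exists (m + a * n), (e * n); split; [lia|nia|].
move=> _ [i /= ile <-].
have ik : i < k.+1 by rewrite (leq_trans ile)// ltnS; exact: leq_bigmax.
have -> : m + a * n + i * (e * n) = m + (a + i * e) * n by nia.
split; last exact: mono.
by apply: mnF; exists (a + i * e) => //=; nia.
Qed.

(** * From AP-sets to multi-non-wandering points *)

Lemma AP_setS (F G : set nat) : F `<=` G -> AP_set F -> AP_set G.
Proof.
move=> FG apF d d0; have [a [n [a0 n0 sub]]] := apF d d0.
by exists a, n; split=> // m /sub /FG.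
Qed.

Lemma AP_set_nonempty (F : set nat) : AP_set F -> F !=set0.
Proof.
move=> /(_ 1 isT)[a [n [_ _ sub]]]; exists a.
by apply: sub; exists 0; rewrite //= mul0n addn0.
Qed.

(** These are the sets that the overview above calls large. *)
Definition AP_visits (X : Type) (T : X -> X) (F : set nat) (x : X) (A : set X) :=
  AP_set (F `&` [set n | A (iter n T x)]).

Lemma AP_visitsU (X : Type) (T : X -> X) F x (A B : set X) :
  AP_visits T F x (A `|` B) -> AP_visits T F x A \/ AP_visits T F x B.
Proof.
move=> /(AP_set_partition_regular (fun n => `[< A (iter n T x) >]))[[] ap].
  by left; apply: AP_setS ap => n [[Fn _] /asboolP].
by right; apply: AP_setS ap => n [[Fn []]// ?] /asboolPn.
Qed.

Lemma AP_visits_multi_non_wandering (X : topologicalType) (T : X -> X) F x y :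
  (forall U, nbhs y U -> AP_visits T F x U) -> multi_non_wandering T y.
Proof.
move=> visits U /open_nbhs_nbhs/visits apU d /apU[a [n [_ n0 sub]]].
exists n => //; exists (iter a T x) => i /= id.
by rewrite -iterD addnC; have [] := sub _ (ex_intro2 _ _ i id erefl).
Qed.

(** A cluster point of the filter of sets with a non-large complement has only
    large neighborhoods, since the complement of such a neighborhood is not in
    the filter. *)
Lemma AP_set_multi_non_wandering (X : topologicalType) (T : X -> X)
    (F : set nat) (x : X) : compact [set: X] -> AP_set F ->
  exists2 y, closure (orbit_along T F x) y & multi_non_wandering T y.
Proof.
move=> cX apF.
pose G : set_system X := [set A | ~ AP_visits T F x (~` A)].
have GF : ProperFilter G.
  split.
    rewrite /G /= => noAP; apply: noAP; apply: AP_setS apF => n Fn.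
    by split=> //; rewrite /= setC0.
  split=> [/AP_set_nonempty[n [_ []]]//|A B GA GB|A B AB GA apB].
    by rewrite /G /= setCI => apAB; have [] := AP_visitsU apAB.
  by apply: GA; apply: AP_setS apB => n [Fn nB]; split=> // /AB.
have [y [_ Gy]] := cX G GF filterT.
have visits U : nbhs y U -> AP_visits T F x U.
  move=> yU; apply: contrapT => nU.
  by have [|z []] := Gy (~` U) U _ yU; first by rewrite /G /= setCK.
exists y; last exact: AP_visits_multi_non_wandering visits.
move=> U /visits/AP_set_nonempty[n [Fn Un]].
by exists (iter n T x); split=> //; exists n.
Qed.

(** * The orbit closure of a word under the shift *)

(** The closure of the shift orbit of [u] in the product space, described by the
    finite prefixes of its words.  The parameter [R] is a phantom: distances are
    in [R], and the topology derived from them has to be determined by the type. *)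
Record shift_orbit_closure (R : realType) (u : nat -> bool) := ShiftOrbitClosure {
  word :> nat -> bool;
  word_prefix : forall n, exists m, forall i, i < n -> word i = u (m + i) }.

HB.instance Definition _ R u := gen_eqMixin (shift_orbit_closure R u).
HB.instance Definition _ R u := gen_choiceMixin (shift_orbit_closure R u).

(** The distance of two distinct words is [1 / (n + 1)], where [n] is the first
    position at which they differ. *)
Definition shift_dist (R : realType) u (v w : shift_orbit_closure R u) : R :=
  if pselect (exists n, v n != w n) is left ex then (ex_minn ex).+1%:R^-1%R else 0%R.

Section ShiftMetric.
Context {R : realType} {u : nat -> bool}.
Implicit Types v w : shift_orbit_closure R u.
Local Open Scope ring_scope.

Lemma shift_orbit_closure_ext v w : (forall n, v n = w n) -> v = w.
Proof.
case: v w => v vP [w wP] /= /funext vw; rewrite vw in vP *.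
by rewrite (Prop_irrelevance vP wP).
Qed.

(** Together with [shift_dist_ge], this says that the distance is the supremum of
    [1 / (n + 1)] over all positions [n] of disagreement, or 0 if there is none; the
    metric axioms follow from this without further mention of the first disagreement. *)
Lemma le_shift_dist v w (e : R) : 0 <= e ->
  (forall n, v n != w n -> n.+1%:R^-1 <= e) -> shift_dist v w <= e.
Proof.
rewrite /shift_dist => e0 le_e; case: pselect => // ex.
by case: ex_minnP => n vwn _; exact: le_e.
Qed.

Lemma shift_dist_ge v w n : v n != w n -> n.+1%:R^-1 <= shift_dist v w.
Proof.
rewrite /shift_dist => vwn; case: pselect => [ex|[]]; last by exists n.
case: ex_minnP => m _ /(_ n vwn) mn.
by rewrite lef_pV2 ?posrE ?ltr0n// ler_nat.
Qed.

Lemma shift_dist_ge0 v w : 0 <= shift_dist v w.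
Proof. by rewrite /shift_dist; case: pselect => // ex; rewrite invr_ge0. Qed.

Lemma shift_distxx v : shift_dist v v = 0.
Proof.
apply/eqP; rewrite eq_le shift_dist_ge0 andbT.
by apply: le_shift_dist => // n; rewrite eqxx.
Qed.

Lemma shift_dist_positivity v w : shift_dist v w = 0 -> v = w.
Proof.
move=> vw0; apply: shift_orbit_closure_ext => n; apply: contrapT => /eqP.
by move=> /shift_dist_ge; rewrite vw0 leNgt invr_gt0 ltr0n.
Qed.

Lemma shift_dist_sym v w : shift_dist v w = shift_dist w v.
Proof.
by apply/eqP; rewrite eq_le; apply/andP; split; apply: le_shift_dist;
  rewrite ?shift_dist_ge0// => n; rewrite eq_sym => /shift_dist_ge.
Qed.

Lemma shift_dist_triangle w v z :
  shift_dist v z <= shift_dist v w + shift_dist w z.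
Proof.
apply: le_shift_dist => [|n vz]; first by rewrite addr_ge0 ?shift_dist_ge0.
have [vw|/shift_dist_ge vw] := eqVneq (v n) (w n).
  by rewrite vw in vz; rewrite ler_wpDl ?shift_dist_ge0 ?shift_dist_ge.
by rewrite ler_wpDr ?shift_dist_ge0.
Qed.

End ShiftMetric.

HB.instance Definition _ (R : realType) u :=
  isMetric.Build R (shift_orbit_closure R u) (@shift_distxx R u)
    (@shift_dist_positivity R u) (@shift_dist_sym R u) (@shift_dist_triangle R u).

(** The ball of radius [1 / (n + 1)] around a word is the cylinder of its first
    [n + 1] letters. *)
Lemma nbhs_shiftP (R : realType) u (v : shift_orbit_closure R u) (A : set _) :
  nbhs v A <->
  exists n, [set w : shift_orbit_closure R u | forall i, i < n -> v i = w i] `<=` A.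
Proof.
split=> [/(@nbhs_ballP R)[e /= e0 ballA]|[n nA]].
  have [n ne] : exists n, (n.+1%:R^-1 < e)%R.
    by have [n _ /(_ n (leqnn n)) ne] := near_infty_natSinv_lt (PosNum e0); exists n.
  exists n => w vw; apply: ballA; rewrite ballEmdist /=.
  apply: le_lt_trans ne; apply: le_shift_dist => [|i].
    by rewrite invr_ge0.
  apply: contraNT => iln; apply/eqP/vw; rewrite ltnNge; apply: contra iln => ni.
  by rewrite lef_pV2 ?posrE ?ltr0n// ler_nat.
apply/(@nbhs_ballP R); exists (n.+1%:R^-1)%R; first by rewrite /= invr_gt0 ltr0n.
move=> w; rewrite ballEmdist /= => vw; apply: nA => i ilt.
apply: contrapT => /eqP /(@shift_dist_ge R); apply/negP.
rewrite -ltNge (lt_le_trans vw)// lef_pV2 ?posrE ?ltr0n// ler_nat; lia.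
Qed.

(** An ultrafilter decides the letter at each position, and so converges to the
    word [z] of its decisions.  That word is in the space because each cylinder
    around it is in the ultrafilter, and hence contains a word of the space. *)
Lemma shift_orbit_closure_compact (R : realType) u :
  compact [set: shift_orbit_closure R u].
Proof.
rewrite compact_ultra => G UG _.
pose z n := `[< G [set w : shift_orbit_closure R u | w n] >].
have Gz n : G [set w : shift_orbit_closure R u | forall i, i < n -> z i = w i].
  elim: n => [|n IH]; first exact: filterS filterT.
  have Gn : G [set w : shift_orbit_closure R u | z n = w n].
    rewrite /z; case: asboolP => [|nG].
      by apply: filterS => w /= ->.
    have [//|] := in_ultra_setVsetC [set w : shift_orbit_closure R u | w n] UG.
    by apply: filterS => w /= /negP/negbTE ->.
  apply: filterS (filterI IH Gn) => w [wlt wn] i.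
  by rewrite ltnS leq_eqVlt => /predU1P[->|/wlt].
have zP n : exists m, forall i, i < n -> z i = u (m + i).
  have [w zw] := filter_ex (Gz n); have [m wu] := word_prefix w n.
  by exists m => i ilt; rewrite zw// wu.
exists (ShiftOrbitClosure R zP); split=> // A /nbhs_shiftP[n nA].
exact: filterS (Gz n).
Qed.

Program Definition shift (R : realType) u (v : shift_orbit_closure R u) :=
  @ShiftOrbitClosure R u (fun n => v n.+1) _.
Next Obligation.
move=> R u v n; have [m vu] := word_prefix v n.+1.
by exists m.+1 => i ilt; rewrite vu// addSnnS.
Qed.

Lemma shift_continuous (R : realType) u : continuous (@shift R u).
Proof.
move=> v A /nbhs_shiftP[n nA]; apply/nbhs_shiftP; exists n.+1 => w vw.
by apply: nA => i ilt /=; exact: vw.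
Qed.

Lemma iter_shiftE (R : realType) u n (v : shift_orbit_closure R u) i :
  iter n (@shift R u) v i = v (n + i).
Proof. by elim: n i => //= n IH i; rewrite IH addnS. Qed.

Lemma generator_prefix (u : nat -> bool) n :
  exists m, forall i, i < n -> u i = u (m + i).
Proof. by exists 0. Qed.

(** * From multi-non-wandering points to AP-sets *)

Lemma multi_non_wandering_AP_set (R : realType) (F : set nat) :
    F `<=` [set n | 0 < n] ->
    (forall (X : metricType R) (T : X -> X), dynamical_system T ->
      forall x : X, exists2 y : X,
        closure (orbit_along T F x) y & multi_non_wandering T y) ->
  AP_set F.
Proof.
move=> Fpos mnwF d d0; pose u n := `[< F n >].
pose x : shift_orbit_closure R u := ShiftOrbitClosure R (generator_prefix u).
have dynS : dynamical_system (@shift R u).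
  by split; [exists x|exact: shift_orbit_closure_compact|exact: shift_continuous].
have [y cly mnwy] := mnwF _ _ dynS x.
have cyl0 (v : shift_orbit_closure R u) : v 0 ->
    nbhs v [set w : shift_orbit_closure R u | w 0].
  by move=> v0; apply/nbhs_shiftP; exists 1 => w /(_ 0 isT) /= <-.
have y0 : y 0.
  have /cly[_ [[n Fn <-] /= ->]] :
      nbhs y [set w : shift_orbit_closure R u | y 0 = w 0].
    by apply/nbhs_shiftP; exists 1 => w; apply.
  by rewrite iter_shiftE addn0; apply/asboolP.
have [|n n0 [v vP]] := mnwy [set w : shift_orbit_closure R u | w 0] _ d d0.
  by split=> //; rewrite openE => w /= /cyl0.
have [m vu] := word_prefix v (d * n).+1.
have sub i : i < d.+1 -> F (m + i * n).
  move=> id; have := vP i id; rewrite /= iter_shiftE addn0 vu.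
    by move/asboolP.
  by rewrite ltnS leq_mul2r; apply/orP; right.
exists m, n; split=> //.
  (* The prefix may occur at [m = 0] only if [0] is in [F]. *)
  by have /Fpos := sub 0 isT; rewrite mul0n addn0.
by move=> _ [i /= id <-]; exact: sub.
Qed.

Theorem theorem6p3 (R : realType) (F : set nat)
    (F_pos : F `<=` [set n | 0 < n]) :
  AP_set F <->
  forall (X : metricType R) (T : X -> X), dynamical_system T ->
  forall x : X, exists2 y : X,
    closure (orbit_along T F x) y & multi_non_wandering T y.
Proof.
split=> [apF X T [_ cX _] x|]; first exact: AP_set_multi_non_wandering.
exact: multi_non_wandering_AP_set.
Qed.
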